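(* Let $n$ be an even integer. (a) For each $n \ge 6$: the traditional formulation and the permutation formulation of the single round robin (SRR) problem with $n$ teams are relaxation-equivalent, and the matching formulation is stronger than the traditional formulation and stronger than the permutation formulation. That is, $v^{\mathrm{LP}}_{\mathrm{tra}}(I) = v^{\mathrm{LP}}_{\mathrm{per}}(I)$ and $v^{\mathrm{LP}}_{\mathrm{mat}}(I) \ge v^{\mathrm{LP}}_{\mathrm{tra}}(I)$ for every SRR instance $I$ with $n$ teams, and there exists an SRR instance $I$ with $n$ teams such that $v^{\mathrm{LP}}_{\mathrm{mat}}(I) > v^{\mathrm{LP}}_{\mathrm{tra}}(I)$. (b) For $n = 4$: the traditional, matching, and permutation formulations of the SRR problem are relaxation-equivalent, i.e., $v^{\mathrm{LP}}_{\mathrm{tra}}(I) = v^{\mathrm{LP}}_{\mathrm{mat}}(I) = v^{\mathrm{LP}}_{\mathrm{per}}(I)$ for every SRR instance $I$ with $4$ teams.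
   Context: Let $n \ge 4$ be even. $T$ is a set of $n$ teams; $\mathcal{M} = \{\{i,j\} : i,j \in T,\ i \ne j\}$ is the set of matches; $\mathcal{M}_i = \{\{i,j\} : j \in T\setminus\{i\}\}$ for $i \in T$; $R = \{1,\dots,n-1\}$ is the set of rounds. An instance $I$ of the single round robin (SRR) problem with $n$ teams is given by an integral cost $c_{m,r} \in \mathbb{Z}$ for each $m \in \mathcal{M}$, $r \in R$. The problem is to find an assignment $\mathcal{A} \subseteq \mathcal{M}\times R$ of minimum cost $\sum_{(m,r)\in\mathcal{A}} c_{m,r}$ such that every team plays a single match per round and each match is played in some round. Each formulation below is an integer program with binary variables; its LP relaxation replaces the binary condition on the variables by non-negativity only. Traditional formulation: $v^{\mathrm{LP}}_{\mathrm{tra}}(I)$ is the minimum of $\sum_{m\in\mathcal{M}}\sum_{r\in R} c_{m,r}x_{m,r}$ over all $x \in \mathbb{R}^{\mathcal{M}\times R}$ with $x \ge 0$, $\sum_{r\in R} x_{m,r} = 1$ for all $m \in \mathcal{M}$, and $\sum_{m\in\mathcal{M}_i} x_{m,r} = 1$ for all $i \in T$, $r \in R$. Matching formulation: Let $\mathfrak{M}$ be the set of all perfect matchings of the complete graph $K_n = (T,\mathcal{M})$, and for $M \in \mathfrak{M}$, $r\in R$ let $d_{M,r} = \sum_{m\in M} c_{m,r}$. Then $v^{\mathrm{LP}}_{\mathrm{mat}}(I)$ is the minimum of $\sum_{M\in\mathfrak{M}}\sum_{r\in R} d_{M,r}y_{M,r}$ over all $y\in\mathbb{R}^{\mathfrak{M}\times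 R}$ with $y\ge 0$, $\sum_{M\in\mathfrak{M}} y_{M,r} = 1$ for all $r\in R$, and $\sum_{M\in\mathfrak{M}: m\in M}\sum_{r\in R} y_{M,r} = 1$ for all $m\in\mathcal{M}$. Permutation formulation: For $i\in T$ let $\Pi^{-i}$ be the set of all permutations (orderings) $\pi = (\pi_1,\dots,\pi_{n-1})$ of $T\setminus\{i\}$, where $\pi_r$ is the opponent of $i$ in round $r$. For $i,j\in T$, $i\neq j$, and $r\in R$ let $\Pi^{-i}_{j,r} = \{\pi\in\Pi^{-i} : \pi_r = j\}$. Let $e_{i,\pi} = \sum_{r\in R} c_{\{i,\pi_r\},r}$. Then $v^{\mathrm{LP}}_{\mathrm{per}}(I)$ is the minimum of $\frac12\sum_{i\in T}\sum_{\pi\in\Pi^{-i}} e_{i,\pi}z_{i,\pi}$ over all $z = (z_{i,\pi})_{i\in T,\pi\in\Pi^{-i}}$ with $z\ge 0$, $\sum_{\pi\in\Pi^{-i}} z_{i,\pi} = 1$ for all $i\in T$, and $\sum_{\pi\in\Pi^{-i}_{j,r}} z_{i,\pi} = \sum_{\pi\in\Pi^{-j}_{i,r}} z_{j,\pi}$ for all $\{i,j\}\in\mathcal{M}$, $r\in R$. Two formulations $f$ and $g$ are relaxation-equivalent if $v^{\mathrm{LP}}_f(I) = v^{\mathrm{LP}}_g(I)$ for every instance $I$. Formulation $f$ is stronger than $g$ if $v^{\mathrm{LP}}_f(I)\ge v^{\mathrm{LP}}_g(I)$ for every instance $I$ and there exists an instance $I$ with $v^{\mathrm{LP}}_f(I)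 > v^{\mathrm{LP}}_g(I)$. For a fixed $n$, these notions refer to the instances with $n$ teams. *)

(* Defs.v *)
From HB Require Import structures.
From mathcomp Require Import all_boot all_order all_algebra.
From mathcomp Require Import boolp classical_sets reals.

Set Implicit Arguments.
Unset Strict Implicit.
Unset Printing Implicit Defensive.

Import Order.TTheory GRing.Theory Num.Theory.

Local Open Scope ring_scope.

(* Teams are 'I_n; round r of {1, ..., n-1} is the ordinal r - 1. *)
Notation team n := 'I_n.
Notation round n := 'I_n.-1.

Definition is_game n (m : {set team n}) : bool := #|m| == 2.

Notation game n := {m : {set team n} | is_game m}.

Lemma is_game_pair n (i j : team n) : i != j -> is_game [set i; j].
Proof. by move=> ij; rewrite /is_game cards2 ij. Qed.

Definition pair_game n (i j : team n) (ij : i != j) : game n :=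
  exist _ [set i; j] (is_game_pair ij).

Definition srr_instance n := game n -> round n -> int.

(* The minimum of the objective [obj] over the set [feas].  If there is no
   minimizer the value is 0; the linear programs below always have one when n
   is even and positive: their feasible sets are nonempty polytopes. *)
Definition lp_min (R : realType) (V : Type) (feas : set V) (obj : V -> R) : R :=
  xget 0 ((obj @` feas)%classic `&` lbound (obj @` feas)%classic)%classic.

Lemma lp_minE (R : realType) (V : Type) (feas : set V) (obj : V -> R) (x : V) :
  feas x -> (forall y, feas y -> obj x <= obj y) -> lp_min feas obj = obj x.
Proof.
move=> fx minx; apply: xget_unique.
  by split; [exists x | move=> _ [y fy <-]; exact: minx].
move=> _ [[y fy <-] lby]; apply/le_anti/andP; split; last exact: minx.
by apply: lby; exists x.
Qed.

Section Traditional.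
Variables (R : realType) (n : nat).

Definition tra_feasible (x : game n -> round n -> R) : Prop :=
  [/\ forall m r, 0 <= x m r,
      forall m, \sum_r x m r = 1
    & forall (i : team n) r, \sum_(m : game n | i \in val m) x m r = 1].

Definition tra_cost (I : srr_instance n) (x : game n -> round n -> R) : R :=
  \sum_m \sum_r (I m r)%:~R * x m r.

Definition v_tra (I : srr_instance n) : R := lp_min tra_feasible (tra_cost I).

End Traditional.

Definition is_perfect_matching n (M : {set game n}) : bool :=
  [forall i : team n, #|[set m in M | i \in val m]| == 1].

Notation perfect_matching n := {M : {set game n} | is_perfect_matching M}.

Section Matching.
Variables (R : realType) (n : nat).

Definition matching_cost (I : srr_instance n) (M : perfect_matching n)
    (r : round n) : int :=
  \sum_(m in val M) I m r.

Definition mat_feasible (y : perfect_matching n -> round n -> R) : Prop :=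
  [/\ forall M r, 0 <= y M r,
      forall r, \sum_M y M r = 1
    & forall m : game n,
        \sum_(M : perfect_matching n | m \in val M) \sum_r y M r = 1].

Definition mat_cost (I : srr_instance n)
    (y : perfect_matching n -> round n -> R) : R :=
  \sum_M \sum_r (matching_cost I M r)%:~R * y M r.

Definition v_mat (I : srr_instance n) : R := lp_min mat_feasible (mat_cost I).

End Matching.

Definition is_ordering n (i : team n) (p : n.-1.-tuple (team n)) : bool :=
  perm_eq p (enum [set~ i]).

Notation ordering i := {p : _.-1.-tuple (team _) | is_ordering i p}.

Definition opponent n (i : team n) (p : ordering i) (r : round n) : team n :=
  tnth (val p) r.

Lemma opponent_neq n (i : team n) (p : ordering i) (r : round n) :
  i != opponent p r.
Proof.
have := mem_tnth r (val p).
by rewrite (perm_mem (valP p)) mem_enum !inE eq_sym.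
Qed.

Section Permutation.
Variables (R : realType) (n : nat).

Definition ordering_cost (I : srr_instance n) (i : team n) (p : ordering i) :
    int :=
  \sum_r I (pair_game (opponent_neq p r)) r.

Definition per_feasible (z : forall i : team n, ordering i -> R) : Prop :=
  [/\ forall i (p : ordering i), 0 <= z i p,
      forall i : team n, \sum_(p : ordering i) z i p = 1
    & forall (i j : team n) (r : round n), i != j ->
        \sum_(p : ordering i | opponent p r == j) z i p =
        \sum_(p : ordering j | opponent p r == i) z j p].

Definition per_cost (I : srr_instance n)
    (z : forall i : team n, ordering i -> R) : R :=
  2%:R^-1 * \sum_i \sum_(p : ordering i) (ordering_cost I p)%:~R * z i p.

Definition v_per (I : srr_instance n) : R := lp_min per_feasible (per_cost I).

End Permutation.

(* A formulation enters the comparison only through the value of its LP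
   relaxation as a function of the instance. *)
Definition relaxation_equivalent (R : realType) n (vf vg : srr_instance n -> R) :
    Prop :=
  forall I, vf I = vg I.

Definition stronger (R : realType) n (vf vg : srr_instance n -> R) : Prop :=
  (forall I, vg I <= vf I) /\ (exists I, vg I < vf I).

(* Main.v *)
Require Import Defs.
From mathcomp Require Import boolp classical_sets reals.
From mathcomp Require Import all_boot all_order all_algebra.
From mathcomp Require Import ring lra zify.

(** A solution of the permutation formulation and a solution of the traditional
    one have equal cost as soon as the latter records, for each game and round,
    the weight with which the two sides of the game play it in that round
    ([per_marginal_cost]).  Every solution [z] determines such an [x].
    Conversely, for each team the weights of its games in [x] form a doubly
    stochastic matrix indexed by rounds and opponents, and Birkhoff's theorem
    ([birkhoff]) splits it into orderings.  So the two programs take the same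
    set of values.  In the same way each solution of the matching formulation
    yields a traditional solution of equal cost ([mat_to_tra]), which gives
    the inequality between the optimal values.  When [n = 4] the converse holds:
    complementary games carry equal weight in each round ([tra_compl]), and a
    pair of complementary games is the same as a perfect matching.

    When [n] is at least 6, let [S] be a set of three teams, and charge 1 for
    each game of one fixed round between [S] and its complement.  Perfect
    matchings cross the odd set [S], so every solution of the matching
    formulation costs at least 1 ([cut_mat_cost_ge1]).  The traditional
    formulation does not see the parity of [S]: uniform fractional weights on the
    games inside [S] and inside its complement give each team degree 1 in the
    fixed round, at no cost ([cut_point_feasible], [cut_point_cost]).

    Both Birkhoff's theorem and the existence of optimal solutions come from one
    principle: a point of a polytope in standard form is a convex combination of
    vertices ([vertex_ind]), and there are finitely many vertices.  Optimal
    solutions of the matching formulation also require a feasible one; the circle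
    method schedules a tournament for every even number of teams
    ([circle_feasible]). *)

Set Implicit Arguments.
Unset Strict Implicit.
Unset Printing Implicit Defensive.

Import Order.TTheory GRing.Theory Num.Theory.

Local Open Scope ring_scope.

(** * Polytopes in standard form with 0/1 coefficients *)

Section Polytope.
Variables (R : realFieldType) (T E : finType) (A : E -> pred T) (b : E -> R).
Implicit Types x k v : T -> R.

Definition polytope x :=
  (forall t, 0 <= x t) /\ (forall e, \sum_(t | A e t) x t = b e).

(** The differences of two solutions of the equations of the polytope. *)
Definition direction k := forall e, \sum_(t | A e t) k t = 0.

(** Extreme points, characterised algebraically: no nonzero direction is
    supported in the support of [x], so [x] cannot be moved both ways. *)
Definition vertex x :=
  polytope x /\
  forall k, direction k -> (forall t, x t = 0 -> k t = 0) -> forall t, k t = 0.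

Definition supp x : {set T} := [set t | x t != 0].

(* This makes the polytope bounded: an equation with coefficients 0 and 1
   bounds each of the nonnegative variables that occur in it. *)
Hypothesis covered : forall t, exists e, A e t.

Lemma direction_neg k t0 : direction k -> k t0 != 0 -> exists t, k t < 0.
Proof.
move=> dk; apply: contraNP => /forallNP k0; have [e Aet0] := covered t0.
have k_ge0 t : 0 <= k t by rewrite leNgt; apply/negP; exact: k0.
by rewrite (psumr_eq0P _ (dk e)).
Qed.

(** Ratio test: move from [x] along [k] until the first coordinate vanishes.
    The support does not grow, and it loses at least that coordinate. *)
Lemma slide x k t0 : polytope x -> direction k ->
  (forall t, x t = 0 -> k t = 0) -> k t0 < 0 ->
  exists2 s, 0 < s &
    polytope (fun t => x t + s * k t) /\
    (#|supp (fun t => (x t + s * k t)%R)| < #|supp x|)%N.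
Proof.
move=> [x0 xb] dk kx kt0.
case: (@arg_minP _ _ _ t0 (fun t => k t < 0) (fun t => x t / - k t) kt0)
  => t1 kt1 min1.
have xpos t : k t < 0 -> 0 < x t.
  move=> kt; rewrite lt_def x0 andbT; apply/eqP => /kx kt'.
  by rewrite kt' ltxx in kt.
exists (x t1 / - k t1); first by rewrite divr_gt0 ?xpos ?oppr_gt0.
set s := x t1 / - k t1.
have s0 : 0 < s by rewrite divr_gt0 ?xpos ?oppr_gt0.
split; [split=> [t|e] |].
- have [kt|kt] := ltP (k t) 0; last by rewrite addr_ge0 // mulr_ge0 // ltW.
  by have := min1 t kt; rewrite ler_pdivlMr ?oppr_gt0 // -subr_ge0 mulrN opprK.
- by rewrite big_split /= -mulr_sumr dk xb mulr0 addr0.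
apply: proper_card; apply/properP; split.
  apply/subsetP=> t; rewrite !inE; apply: contraNN => /eqP xt.
  by rewrite xt (kx _ xt) mulr0 addr0.
exists t1; rewrite !inE; first by rewrite gt_eqF ?xpos.
by rewrite negbK /s invrN mulrN mulNr divfK ?subrr // lt_eqF.
Qed.

(** Minkowski's theorem as an induction principle.  A point that is not a vertex
    admits a direction inside its support; sliding along it and along its
    opposite writes the point as a convex combination of two points of smaller
    support, so induction on the size of the support applies. *)
Lemma vertex_ind (P : (T -> R) -> Prop) :
  (forall v, vertex v -> P v) ->
  (forall x y a, 0 <= a <= 1 -> P x -> P y ->
     P (fun t => a * x t + (1 - a) * y t)) ->
  forall x, polytope x -> P x.
Proof.
move=> Pv Pconv x; have [n] := ubnP #|supp x|; elim: n x => // n IHn x ltxn px.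
have [vx|nvx] := pselect (vertex x); first exact: Pv.
have [k [dk kx [t0 kt0]]] : exists k, [/\ direction k,
    forall t, x t = 0 -> k t = 0 & exists t, k t != 0].
  apply: contra_notP nvx => nk; split=> // k dk kx t; apply: contra_notP nk.
  by move=> /eqP kt; exists k; split=> //; exists t.
have dNk : direction (fun t => - k t) by move=> e; rewrite sumrN dk oppr0.
have kNx t : x t = 0 -> - k t = 0 by move/kx->; rewrite oppr0.
have [t1 kt1] := direction_neg dk kt0.
have [|t2 kt2] := @direction_neg (fun t => - k t) t0 dNk.
  by rewrite oppr_eq0.
have [s s0 [ps lts]] := slide px dk kx kt1.
have [s' s'0 [ps' lts']] := slide px dNk kNx kt2.
have ss0 : 0 < s + s' by exact: addr_gt0.
have -> : x = fun t => s' / (s + s') * (x t + s * k t) +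
                       (1 - s' / (s + s')) * (x t + s' * - k t).
  by apply/funext => t; field; rewrite gt_eqF.
apply: Pconv; last 2 first.
- by apply: IHn ps; exact: leq_trans lts _.
- by apply: IHn ps'; exact: leq_trans lts' _.
apply/andP; split; first by apply/divr_ge0; apply/ltW.
by rewrite ler_pdivrMr // mul1r lerDr ltW.
Qed.

(** The difference of two vertices of equal support is a direction inside that
    support.  Hence there are at most as many vertices as sets of indices. *)
Lemma vertex_supp_inj v w : vertex v -> vertex w -> supp v = supp w -> v = w.
Proof.
move=> [[_ vb] vv] [[_ wb] _] /setP vw; apply/funext => t.
apply/eqP; rewrite -subr_eq0; apply/eqP.
apply: (vv (fun t => v t - w t)) => [e|{}t vt]; first by rewrite sumrB vb wb subrr.
by have := vw t; rewrite !inE vt eqxx => /esym/negbFE/eqP->; rewrite subrr.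
Qed.

(** Every point is weakly improved by some vertex, and a vertex is determined by
    its support, so it suffices to compare one candidate per support. *)
Lemma lp_attained (c : T -> R) : (exists x, polytope x) ->
  exists2 v, polytope v &
    forall x, polytope x -> \sum_t c t * v t <= \sum_t c t * x t.
Proof.
move=> [x0 px0]; pose obj x := \sum_t c t * x t.
pose rep (S : {set T}) : T -> R :=
  xget (fun=> 0) [set v | vertex v /\ supp v = S]%classic.
have rep_supp v : vertex v -> rep (supp v) = v.
  by move=> vv; apply: xget_unique => // w [vw /(vertex_supp_inj vw vv)].
have below x : polytope x -> exists2 v, vertex v & obj v <= obj x.
  (* The better of the two end points is at least as good as the combination. *)
  pose P x := exists2 v, vertex v & obj v <= obj x.
  apply: (vertex_ind (P := P)) => [v vv|]; first by exists v.
  move=> {}x y a /andP[a0 a1] [v vv vx] [w vw wy].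
  rewrite /P; have -> : obj (fun t => a * x t + (1 - a) * y t) =
                        a * obj x + (1 - a) * obj y.
    rewrite /obj !mulr_sumr -big_split; apply: eq_bigr => t _ /=; ring.
  have [xy|/ltW yx] := leP (obj x) (obj y).
    exists v => //; apply: le_trans vx _; nra.
  by exists w => //; apply: le_trans wy _; nra.
have [v0 vv0 _] := below _ px0.
have v0P : `[< vertex (rep (supp v0)) >] by apply/asboolP; rewrite rep_supp.
case: (@arg_minP _ _ _ _ (fun S => `[< vertex (rep S) >])
         (fun S => obj (rep S)) v0P) => S /asboolP vS minS.
exists (rep S) => [|x px]; first by case: vS.
have [v vv] := below _ px; apply: le_trans.
by rewrite -(rep_supp _ vv); apply: minS; apply/asboolP; rewrite rep_supp.
Qed.

End Polytope.

(** * Transportation polytopes *)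

Lemma sum_pair (V : nmodType) (I J : finType) (P : pred I) (Q : pred J)
    (F : I * J -> V) :
  \sum_(t | P t.1 && Q t.2) F t = \sum_(i | P i) \sum_(j | Q j) F (i, j).
Proof. by rewrite pair_big /=; apply: eq_bigr => -[]. Qed.

Lemma sum_row (V : nmodType) (I J : finType) (i : I) (F : I * J -> V) :
  \sum_(t | t.1 == i) F t = \sum_j F (i, j).
Proof.
have := sum_pair (pred1 i) predT F; rewrite big_pred1_eq => <-.
by apply: eq_bigl => t; rewrite andbT.
Qed.

Lemma sum_col (V : nmodType) (I J : finType) (P : pred I) (j : J)
    (F : I * J -> V) :
  \sum_(t | P t.1 && (t.2 == j)) F t = \sum_(i | P i) F (i, j).
Proof.
by rewrite (sum_pair P (pred1 j)); apply: eq_bigr => i _; rewrite big_pred1_eq.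
Qed.

(** A homogeneous linear system with fewer equations than unknowns. *)
Lemma nontrivial_solution (F : fieldType) (T E : finType) (A : E -> pred T)
    (S : {set T}) (Q : {set E}) : (#|Q| < #|S|)%N ->
  exists k : T -> F, [/\ exists2 t, t \in S & k t != 0,
    forall t, t \notin S -> k t = 0
    & forall e, e \in Q -> \sum_(t | A e t) k t = 0].
Proof.
move=> QS; pose B : 'M[F]_(#|S|, #|Q|) :=
  \matrix_(i, j) (A (enum_val j) (enum_val i))%:R.
have /rowV0Pn[u /sub_kermxP uB /rV0Pn[i0 ui0]] : kermx B != 0.
  by rewrite kermx_eq0 -row_leq_rank -ltnNge (leq_ltn_trans (rank_leq_col B)).
pose k t := \sum_(i | enum_val i == t) u 0 i.
have kE i : k (enum_val i) = u 0 i.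
  by rewrite /k (big_pred1 i) // => i' /=; rewrite (inj_eq enum_val_inj).
exists k; split.
- by exists (enum_val i0); rewrite ?enum_valP ?kE.
- move=> t tS; apply: big1 => i /eqP it.
  by move: tS; rewrite -it enum_valP.
move=> e eQ; have /matrixP/(_ 0 (enum_rank_in eQ e)) := uB.
rewrite !mxE => uB0; rewrite -[RHS]uB0 (exchange_big_dep predT) //=.
apply: eq_bigr => i _; rewrite mxE enum_rankK_in //.
rewrite big_mkcond /= (bigD1 (enum_val i)) //= eqxx andbT.
rewrite big1 => [|t ti]; first by rewrite addr0; case: ifP; rewrite ?mulr1 ?mulr0.
by rewrite [_ == t]eq_sym (negbTE ti) andbF.
Qed.

Section Transport.
Variables (R : archiRealFieldType) (K J : finType) (d : J -> nat).

Definition on_line (e : K + J) (t : K * J) :=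
  match e with inl k => t.1 == k | inr j => t.2 == j end.

Definition line_sum (e : K + J) : R :=
  match e with inl _ => 1 | inr j => (d j)%:R end.

Lemma card_lines t : #|[set e | on_line e t]| = 2%N.
Proof.
rewrite (_ : [set e | _] = [set inl t.1; inr t.2]) ?cards2 //.
by apply/setP=> -[k|j]; rewrite !inE /= ?orbF eq_sym.
Qed.

(** Suppose that the set [F] of non-integral cells is not empty.  A line meeting
    [F] meets it twice, because its sum is an integer; each cell lies on two
    lines; so at most [#|F|] lines meet [F].  The sums along all of them but one
    row are fewer than [#|F|] equations, hence some nonzero [k] supported in [F]
    satisfies them.  The remaining row sum is then zero as well, since the rows
    and the columns have the same total, and [k] contradicts extremality. *)
Lemma vertex_transport_int v t :
  vertex on_line line_sum v -> v t \is a Num.int.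
Proof.
move=> [[v0 vl] vv]; apply: contraT => t0F.
pose F := [set t | v t \isn't a Num.int].
pose L := [set e | [exists t in F, on_line e t]].
have line_int e : line_sum e \is a Num.int.
  by case: e => [k|j] /=; rewrite ?rpred1 ?rpred_nat.
have two_frac e : e \in L -> (2 <= #|[set t in F | on_line e t]|)%N.
  rewrite inE => /existsP[t1 /andP[t1F et1]]; rewrite ltnNge; apply/negP => le1.
  have uniqF t2 : t2 \in F -> on_line e t2 -> t2 = t1.
    move=> t2F et2; apply: (card_le1_eqP le1); rewrite inE ?t2F ?t1F //.
  move: t1F; rewrite inE => /negP; apply.
  have := vl e; rewrite (bigD1 t1) //= => /(canRL (addrK _))->.
  rewrite rpredB ?line_int // rpred_sum // => t2 /andP[et2 t21].
  by apply: contraNT t21 => t2F; apply/eqP/uniqF; rewrite ?inE.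
have LF : (#|L| <= #|F|)%N.
  rewrite -(leq_pmul2r (isT : 0 < 2)%N) -sum_nat_const.
  apply: (@leq_trans (\sum_(e in L) #|[set t in F | on_line e t]|)).
    exact: leq_sum.
  rewrite -sum_nat_const; under [leqRHS]eq_bigr => t1 _ do rewrite -(card_lines t1).
  under eq_bigr do rewrite -sum1dep_card.
  under [leqRHS]eq_bigr do rewrite -sum1dep_card.
  rewrite (exchange_big_dep (mem F)) /=; last by move=> e t1 _ /andP[].
  apply: leq_sum => t1 t1F; rewrite !sum1dep_card; apply/subset_leq_card.
  by apply/subsetP => e; rewrite !inE => /and3P[].
have tF : t \in F by rewrite inE.
have tL : inl t.1 \in L by rewrite inE; apply/existsP; exists t; rewrite tF /=.
have [|k [[t1 t1F kt1] kF kL]] :=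
    @nontrivial_solution R _ _ on_line F (L :\ inl t.1).
  by rewrite (leq_trans _ LF) // [in leqRHS](cardsD1 (inl t.1)) tL.
case/eqP: kt1; apply: vv => [|t2 vt2]; last by apply: kF; rewrite inE vt2 rpred0.
have kline e : e != inl t.1 -> \sum_(t | on_line e t) k t = 0.
  move=> et; have [eL|eL] := boolP (e \in L).
    by apply: kL; rewrite inE in_set1 et.
  apply: big1 => t2 et2; apply: kF; apply: contraNN eL => t2F.
  by rewrite inE; apply/existsP; exists t2; rewrite t2F.
move=> e; have [->|] := eqVneq e (inl t.1); last exact: kline.
have : \sum_t k t = 0.
  rewrite (partition_big snd predT) //= big1 // => j _.
  exact: (kline (inr j)).
rewrite (partition_big fst predT) //= (bigD1 t.1) //= [X in _ + X]big1 ?addr0 //.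
by move=> k' k't; exact: (kline (inl k')).
Qed.

Definition has_fibers (f : {ffun K -> J}) : bool :=
  [forall j, #|[set k | f k == j]| == d j].

(** Birkhoff's theorem for row sums 1 and column sums [d j]: a vertex is the 0/1
    matrix of a function, whose fibers have the prescribed sizes.  The case of
    column sums in {0, 1} gives bijections onto the columns of sum 1. *)
Theorem birkhoff (x : K -> J -> R) :
  (forall k j, 0 <= x k j) -> (forall k, \sum_j x k j = 1) ->
  (forall j, \sum_k x k j = (d j)%:R) ->
  exists w : {f | has_fibers f} -> R,
    [/\ forall f, 0 <= w f, \sum_f w f = 1
      & forall k j, \sum_(f : {f | has_fibers f} | val f k == j) w f = x k j].
Proof.
move=> x0 xrow xcol.
pose P (y : K * J -> R) := exists w : {f | has_fibers f} -> R,
    [/\ forall f, 0 <= w f, \sum_f w f = 1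
      & forall k j, \sum_(f : {f | has_fibers f} | val f k == j) w f = y (k, j)].
suff: P (fun t => x t.1 t.2) by [].
apply: (@vertex_ind _ _ _ on_line line_sum).
- by move=> t; exists (inl t.1) => /=.
- move=> v vv; have vint t := vertex_transport_int t vv.
  have [[v0 vl] _] := vv.
  have vrow k : \sum_j v (k, j) = 1 by rewrite -sum_row; exact: (vl (inl k)).
  have vcol j : \sum_k v (k, j) = (d j)%:R.
    by rewrite -(sum_col predT); exact: (vl (inr j)).
  have /fin_all_exists[g gP] k : exists j, forall j', v (k, j') = (j == j')%:R.
    have /existsP[j vj] : [exists j, v (k, j) != 0].
      rewrite -negb_forall; apply/negP => /forallP v_0.
      have := vrow k; rewrite big1 => [/eqP|j _]; last exact/eqP.
      by rewrite eq_sym oner_eq0.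
    exists j; have vj1 : 1 <= v (k, j) by rewrite -[v _]ger0_norm ?norm_intr_ge1.
    have := vrow k; rewrite (bigD1 j) //=.
    have s0 : 0 <= \sum_(i | i != j) v (k, i) by apply: sumr_ge0.
    move=> vs j'; have [<-|jj'] := eqVneq j j'.
      by apply/eqP; rewrite eq_le vj1 andbT -[leRHS]vs lerDl.
    apply: (psumr_eq0P (P := fun i => i != j) (F := fun i => v (k, i))) => //.
      lra.
    by rewrite eq_sym.
  pose f := [ffun k => g k].
  have fP : has_fibers f.
    apply/forallP => j; rewrite -(eqr_nat R) -vcol -sum1dep_card natr_sum.
    rewrite big_mkcond; apply/eqP/eq_bigr => k _ /=.
    by rewrite ffunE gP; case: eqP.
  pose f' : {f | has_fibers f} := exist _ f fP.
  exists (fun h => (h == f')%:R); split=> [h||k j]; first exact: ler0n.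
    by rewrite (bigD1 f') //= eqxx big1 ?addr0 // => h /negbTE->.
  rewrite big_mkcond (bigD1 f') //= eqxx big1 => [|h /negbTE->].
    by rewrite addr0 gP /f ffunE; case: eqP.
  by rewrite if_same.
- move=> y z a /andP[a0 a1] [w [w0 w1 wy]] [w' [w'0 w'1 wz]].
  have a1' : 0 <= 1 - a by rewrite subr_ge0.
  exists (fun f => a * w f + (1 - a) * w' f); split=> [f||k j].
  + by rewrite addr_ge0 // mulr_ge0.
  + by rewrite big_split -!mulr_sumr w1 w'1 /= !mulr1 addrC subrK.
  + by rewrite big_split -!mulr_sumr wy wz.
split=> [t|[k|j]] //=; first by rewrite sum_row; exact: xrow.
by rewrite -(xcol j); exact: (sum_col predT j (fun t => x t.1 t.2)).
Qed.

End Transport.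

(** * Comparing optimal values of linear programs *)

Lemma lp_min_image (R : realType) (V W : Type) (feas : set V) (feas' : set W)
    (obj : V -> R) (obj' : W -> R) :
  (forall x, feas x -> exists2 y, feas' y & obj' y = obj x) ->
  (forall y, feas' y -> exists2 x, feas x & obj x = obj' y) ->
  lp_min feas obj = lp_min feas' obj'.
Proof.
move=> to_ from; suff img : (obj @` feas = obj' @` feas')%classic.
  by rewrite /lp_min img.
apply/seteqP; split=> _ [x fx <-]; first by have [y fy <-] := to_ x fx; exists y.
by have [y fy <-] := from x fx; exists y.
Qed.

(** [lp_attained] for variables indexed by pairs in curried form, as in the
    traditional and the matching formulations. *)
Lemma lp_min_attained (R : realType) (E U J : finType) (A : E -> pred (U * J))
    (feas : set (U -> J -> R)) (c : U -> J -> R) :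
  (forall t, exists e, A e t) ->
  (forall x, feas x <-> polytope A (fun=> 1) (fun t => x t.1 t.2)) ->
  (exists x, feas x) ->
  exists2 x, feas x &
    forall y, feas y -> \sum_u \sum_j c u j * x u j <= \sum_u \sum_j c u j * y u j.
Proof.
move=> cov feasE [x0 fx0].
have [|v pv vmin] := @lp_attained _ _ _ _ (fun=> 1) cov (fun t => c t.1 t.2).
  by exists (fun t => x0 t.1 t.2); apply/feasE.
have vE : v = fun t => v (t.1, t.2) by apply/funext => -[].
exists (fun u j => v (u, j)) => [|y /feasE /vmin]; first by apply/feasE; rewrite -vE.
by rewrite !pair_big /=; congr (_ <= _); apply: eq_bigr => -[].
Qed.

(** * Games and opponents *)

Section Games.
Variable n : nat.
Implicit Types (i j : team n) (m : game n) (r : round n).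

Lemma gameP i m : i \in val m -> exists j (ij : i != j), m = pair_game ij.
Proof.
have /cards2P[a [b [ab mE]]] := valP m; rewrite mE !inE => /orP[] /eqP->.
  by exists b, ab; apply: val_inj.
by rewrite eq_sym in ab; exists a, ab; apply: val_inj; rewrite mE setUC.
Qed.

Lemma pair_set_inj i : {in predC1 i &, injective (fun j => [set i; j])}.
Proof.
by move=> j k ji _ /setP/(_ j); rewrite !inE eqxx orbT (negbTE ji) => /esym/eqP.
Qed.

Lemma game_inhabited m : exists i, i \in val m.
Proof.
by case: m => m gm /=; apply/set0Pn; rewrite -card_gt0 (eqP gm).
Qed.

Lemma sum_by_opponent (V : nmodType) i (f : game n -> V) :
  \sum_(m : game n | i \in val m) f m =
  \sum_(j | j != i) \sum_(m : game n | val m == [set i; j]) f m.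
Proof.
rewrite [RHS](exchange_big_dep (fun m : game n => i \in val m)) /=; last first.
  by move=> j m _ /eqP->; rewrite !inE eqxx.
apply: eq_bigr => m /gameP[j [ij ->]]; rewrite (big_pred1 j) // => k /=.
by apply/andP/eqP => [[ki /eqP/pair_set_inj->]|->] //; rewrite ?inE 1?eq_sym //.
Qed.

Lemma sum_opponents (V : nmodType) i (F : {set team n} -> V) :
  \sum_(m : game n | i \in val m) F (val m) = \sum_(j | j != i) F [set i; j].
Proof.
rewrite sum_by_opponent; apply: eq_bigr => j; rewrite eq_sym => ij.
by rewrite (big_pred1 (pair_game ij)).
Qed.

Lemma card_game m : #|val m| = 2%N.
Proof. exact/eqP/(valP m). Qed.

Lemma sum_sides (V : nmodType) m (c : V) : \sum_(i in val m) c = c *+ 2.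
Proof. by rewrite sumr_const card_game. Qed.

Lemma pair_gameC i j (ij : i != j) (ji : j != i) : pair_game ij = pair_game ji.
Proof. by apply: val_inj; rewrite /= setUC. Qed.

Definition plays i (p : ordering i) r : game n := pair_game (opponent_neq p r).

Lemma mem_plays i (p : ordering i) r : i \in val (plays p r).
Proof. by rewrite !inE eqxx. Qed.

Lemma playsE i j (ij : i != j) (p : ordering i) r :
  (plays p r == pair_game ij) = (opponent p r == j).
Proof.
rewrite -val_eqE /=; apply/eqP/eqP => [|->//].
by apply: pair_set_inj; rewrite ?inE eq_sym // opponent_neq.
Qed.

Lemma plays_once i (p : ordering i) m : i \in val m ->
  exists r0, forall r, (plays p r == m) = (r == r0).
Proof.
case/gameP=> j [ij ->]; have pj : j \in val p.
  by rewrite (perm_mem (valP p)) mem_enum !inE eq_sym.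
have /tuple_uniqP p_inj : uniq (val p) by rewrite (perm_uniq (valP p)) enum_uniq.
by case/tnthP: pj => r0 jE; exists r0 => r; rewrite playsE jE (inj_eq p_inj).
Qed.

End Games.

(** * The traditional and the permutation formulations *)

(** The orderings of [~: [set i]], in the form in which Birkhoff's theorem
    produces them. *)
Local Notation opponent_map i :=
  {f : {ffun round _ -> team _} | has_fibers (fun j => (j != i) : nat) f}.

Section TraPer.
Variables (R : realType) (n : nat).
Implicit Types (x : game n -> round n -> R).
Implicit Types (z : forall i : team n, ordering i -> R).

(** The value [x m r] is the weight with which either side of [m] plays [m] in
    round [r]: the relation under which [x] and [z] have the same cost. *)
Definition per_marginal x z := forall i (m : game n) (r : round n), i \in val m ->
  \sum_(p : ordering i | plays p r == m) z i p = x m r.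

Lemma per_marginal_sum x z i (c : game n -> R) r : per_marginal x z ->
  \sum_(m : game n | i \in val m) c m * x m r =
  \sum_(p : ordering i) c (plays p r) * z i p.
Proof.
move=> xz.
rewrite [RHS](partition_big (fun p => plays p r) (fun m => i \in val m)) /=.
  apply: eq_bigr => m im; rewrite -(xz i) // mulr_sumr.
  by apply: eq_bigr => p /eqP->.
by move=> p _; exact: mem_plays.
Qed.

(** The factor 1/2 of the permutation formulation compensates for each game being
    counted by both of its sides. *)
Lemma per_marginal_cost I x z : per_marginal x z -> per_cost I z = tra_cost I x.
Proof.
move=> xz; rewrite /per_cost /tra_cost.
have -> : \sum_i \sum_(p : ordering i) (ordering_cost I p)%:~R * z i p =
  \sum_i \sum_r \sum_(m : game n | i \in val m) (I m r)%:~R * x m r.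
  apply: eq_bigr => i _.
  under [RHS]eq_bigr => r _ do
    rewrite (per_marginal_sum i (fun m => (I m r)%:~R) r xz).
  rewrite exchange_big; apply: eq_bigr => p _ /=.
  by rewrite /ordering_cost rmorph_sum mulr_suml.
rewrite exchange_big [RHS]exchange_big mulr_sumr /=.
apply: eq_bigr => r _; rewrite (exchange_big_dep predT) //= mulr_sumr.
apply: eq_bigr => m _; rewrite sum_sides.
by rewrite -[X in _ * X = _]mulr_natl mulKf ?pnatr_eq0.
Qed.

Lemma per_marginal_feasible x z : per_marginal x z -> (forall i p, 0 <= z i p) ->
  (forall i, \sum_(p : ordering i) z i p = 1) -> tra_feasible x.
Proof.
move=> xz z0 z1; split=> [m r|m|i r].
- by have [i im] := game_inhabited m; rewrite -(xz i) // sumr_ge0.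
- have [i im] := game_inhabited m; under eq_bigr do rewrite -(xz i) //.
  rewrite (exchange_big_dep predT) //= -[RHS](z1 i); apply: eq_bigr => p _.
  have [r0 r0P] := plays_once p im.
  by under eq_bigl do rewrite r0P; rewrite big_pred1_eq.
- have := per_marginal_sum i (fun=> 1) r xz.
  by under eq_bigr do rewrite mul1r; under [RHS]eq_bigr do rewrite mul1r; rewrite z1.
Qed.

(** The two sides of a game agree on its weight, by the last constraint of the
    permutation formulation.  Averaging over the sides defines [x] without
    choosing one of them. *)
Lemma per_to_tra z :
  per_feasible z -> exists2 x, tra_feasible x & per_marginal x z.
Proof.
move=> [z0 z1 zE].
pose x (m : game n) r := 2%:R^-1 *
  \sum_(i in val m) \sum_(p : ordering i | plays p r == m) z i p.
have xz : per_marginal x z.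
  move=> i m r /gameP[j [ij ->]]; have ji : j != i by rewrite eq_sym.
  rewrite /x big_setU1 ?inE //= big_set1.
  under eq_bigl do rewrite playsE.
  under [X in _ + X]eq_bigl do rewrite (pair_gameC _ ji) playsE.
  by rewrite -zE // -mulr2n -[X in _ = _ * X]mulr_natl mulKf ?pnatr_eq0.
by exists x => //; exact: per_marginal_feasible xz z0 z1.
Qed.

(** For a fixed team [i], the matrix of the weights of the games of [i], indexed
    by rounds and opponents, has row sums 1 and column sums 1, except for the
    zero column of [i] itself.  Birkhoff's theorem splits it into orderings. *)
Lemma tra_to_per x :
  tra_feasible x -> exists2 z, per_feasible z & per_marginal x z.
Proof.
move=> [x0 x1 xi].
pose y i r j := \sum_(m : game n | val m == [set i; j]) x m r.
have y_pair i j (ij : i != j) r : y i r j = x (pair_game ij) r.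
  by rewrite /y (big_pred1 (pair_game ij)).
have yii i r : y i r i = 0.
  rewrite /y big1 // => m /eqP mE.
  by have := valP m; rewrite mE setUid /is_game cards1.
have bk i : exists w : opponent_map i -> R,
    [/\ forall f, 0 <= w f, \sum_f w f = 1
      & forall r j, \sum_(f : opponent_map i | val f r == j) w f = y i r j].
  apply: birkhoff => [r j|r|j]; first exact: sumr_ge0.
    by rewrite (bigD1 i) //= yii add0r -(xi i r) sum_by_opponent.
  have [->|ji] := eqVneq j i; first by apply: big1 => r _.
  rewrite eq_sym in ji; under eq_bigr do rewrite (y_pair _ _ ji).
  exact: x1.
have to_ordering i (f : {ffun round n -> team n}) :
    has_fibers (fun j => (j != i) : nat) f -> is_ordering i [tuple f r | r < n.-1].
  move=> /forallP fP; apply/allP => j _ /=.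
  rewrite [X in _ == X]count_uniq_mem ?enum_uniq // mem_enum !inE -(eqP (fP j)).
  by rewrite count_map -size_filter cardsE cardE enumT; apply/eqP.
pose to i (f : opponent_map i) : ordering i :=
  exist (fun p => is_ordering i p) _ (to_ordering i _ (valP f)).
have opp_to i f r : opponent (to i f) r = val f r by rewrite /opponent tnth_mktuple.
pose w i := sval (cid (bk i)); have wP i := svalP (cid (bk i)).
pose z i (p : ordering i) := \sum_(f : opponent_map i | to i f == p) w i f.
have zsum i (Q : pred (ordering i)) :
    \sum_(p | Q p) z i p = \sum_(f : opponent_map i | Q (to i f)) w i f.
  rewrite [RHS](partition_big (to i) Q) //=; apply: eq_bigr => p Qp.
  by apply: eq_bigl => f; case: eqP => [->|]; rewrite ?Qp ?andbF.
have z_pair i j (ij : i != j) r :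
    \sum_(p : ordering i | opponent p r == j) z i p = x (pair_game ij) r.
  rewrite zsum; under eq_bigl do rewrite opp_to.
  by have [_ _ ->] := wP i; rewrite (y_pair _ _ ij).
exists z; last first.
  move=> i m r /gameP[j [ij ->]]; rewrite -(z_pair i j ij).
  by apply: eq_bigl => p; rewrite playsE.
split=> [i p|i|i j r ij]; first by apply: sumr_ge0 => f _; have [->] := wP i.
  by rewrite zsum; have [_ -> _] := wP i.
have ji : j != i by rewrite eq_sym.
by rewrite (z_pair i j ij) (z_pair j i ji) (pair_gameC ij ji).
Qed.

Lemma v_tra_per (I : srr_instance n) : v_tra R I = v_per R I.
Proof.
apply: lp_min_image => [x /tra_to_per[z fz xz]|z /per_to_tra[x fx xz]].
  by exists z; rewrite ?(per_marginal_cost I xz).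
by exists x; rewrite ?(per_marginal_cost I xz).
Qed.
End TraPer.

(** * The traditional and the matching formulations *)

Section Matching.
Variables (R : realType) (n : nat).
Implicit Types (x : game n -> round n -> R).
Implicit Types (y : perfect_matching n -> round n -> R).

(** Analogue of [per_marginal]: under this relation [x] and [y] have the same
    cost. *)
Definition mat_marginal x y := forall (m : game n) (r : round n),
  \sum_(M : perfect_matching n | m \in val M) y M r = x m r.

Lemma matching_game_of (M : perfect_matching n) (i : team n) :
  exists m0 : game n, forall m : game n,
    (i \in val m) && (m \in val M) = (m == m0).
Proof.
have /forallP/(_ i)/cards1P[m0 m0E] := valP M.
by exists m0 => m; move/setP/(_ m): m0E; rewrite !inE andbC.
Qed.

Lemma mat_marginal_degree x y (i : team n) r : mat_marginal x y ->
  \sum_(m : game n | i \in val m) x m r = \sum_M y M r.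
Proof.
move=> xy; under eq_bigr do rewrite -xy.
rewrite (exchange_big_dep predT) //=; apply: eq_bigr => M _.
have [m0 m0E] := matching_game_of M i.
by rewrite (big_pred1 m0).
Qed.

Lemma mat_marginal_cost I x y : mat_marginal x y -> mat_cost I y = tra_cost I x.
Proof.
move=> xy; rewrite /mat_cost /tra_cost exchange_big [RHS]exchange_big /=.
apply: eq_bigr => r _.
under [RHS]eq_bigr do rewrite -xy mulr_sumr.
rewrite [RHS](exchange_big_dep predT) //=; apply: eq_bigr => M _.
by rewrite /matching_cost rmorph_sum mulr_suml.
Qed.

Lemma mat_to_tra y :
  mat_feasible y -> exists2 x, tra_feasible x & mat_marginal x y.
Proof.
move=> [y0 y1 ym].
pose x (m : game n) r := \sum_(M : perfect_matching n | m \in val M) y M r.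
have xy : mat_marginal x y by [].
exists x => //; split=> [m r|m|i r]; first exact: sumr_ge0.
  by rewrite -[RHS](ym m) exchange_big.
by rewrite (mat_marginal_degree i r xy).
Qed.

Lemma mat_marginal_feasible x y :
  (0 < n)%N -> (forall M r, 0 <= y M r) -> mat_marginal x y ->
  tra_feasible x -> mat_feasible y.
Proof.
move=> n0 y0 xy [x0 x1 xi]; split=> // [r|m].
  by rewrite -(mat_marginal_degree (Ordinal n0) r xy).
by rewrite exchange_big -[RHS](x1 m); apply: eq_bigr => r _; exact: xy.
Qed.

Lemma tra_attained I : (exists x, tra_feasible x) ->
  exists2 x : game n -> round n -> R, tra_feasible x &
    forall x', tra_feasible x' -> tra_cost I x <= tra_cost I x'.
Proof.
pose A (e : game n + team n * round n) (t : game n * round n) :=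
  match e with
  | inl m => t.1 == m
  | inr ir => (ir.1 \in val t.1) && (t.2 == ir.2)
  end.
apply: (lp_min_attained (A := A)) => [t|x]; first by exists (inl t.1) => /=.
split=> [[x0 x1 xi]|[x0 xe]].
  split=> [t|[m|[i r]]] //=; first by rewrite sum_row; exact: x1.
  rewrite -(xi i r).
  exact: (sum_col (fun m : game n => i \in val m) r (fun t => x t.1 t.2)).
split=> [m r|m|i r]; first exact: (x0 (m, r)).
  by have := xe (inl m); rewrite sum_row.
have := xe (inr (i, r)) => /= <-; apply/esym.
exact: (sum_col (fun m : game n => i \in val m) r (fun t => x t.1 t.2)).
Qed.

Lemma mat_attained I : (exists y, mat_feasible y) ->
  exists2 y : perfect_matching n -> round n -> R, mat_feasible y &
    forall y', mat_feasible y' -> mat_cost I y <= mat_cost I y'.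
Proof.
pose A (e : round n + game n) (t : perfect_matching n * round n) :=
  match e with inl r => t.2 == r | inr m => m \in val t.1 end.
apply: (lp_min_attained (A := A)) => [t|y]; first by exists (inl t.2) => /=.
have sumE m : \sum_(t : perfect_matching n * round n | m \in val t.1) y t.1 t.2 =
    \sum_(M : perfect_matching n | m \in val M) \sum_r y M r.
  rewrite -(sum_pair (fun M : perfect_matching n => m \in val M) predT
    (fun t => y t.1 t.2)).
  by apply: eq_bigl => t; rewrite andbT.
split=> [[y0 y1 ym]|[y0 ye]].
  split=> [t|[r|m]] //=; last by rewrite sumE; exact: ym.
  by rewrite -(y1 r); exact: (sum_col predT r (fun t => y t.1 t.2)).
split=> [M r|r|m]; first exact: (y0 (M, r)).
  have := ye (inl r) => /= <-; apply/esym.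
  exact: (sum_col predT r (fun t => y t.1 t.2)).
by rewrite -sumE; exact: (ye (inr m)).
Qed.

End Matching.

(** * Four teams *)

(** Double counting of the pairs of a team in [A] and a game of that team. *)
Lemma tra_incidences (R : realType) n (x : game n -> round n -> R)
    (A : {set team n}) r :
  tra_feasible x -> \sum_m x m r *+ #|val m :&: A| = #|A|%:R.
Proof.
move=> [_ _ xi]; rewrite -sum1_card natr_sum.
under [RHS]eq_bigr => i _ do rewrite -(xi i r).
rewrite (exchange_big_dep predT) //=; apply: eq_bigr => m _.
by rewrite -sumr_const; apply: eq_bigl => i; rewrite inE andbC.
Qed.

Section FourTeams.
Variable R : realType.

Lemma is_game_setC (m : game 4) : is_game (~: val m).
Proof. by rewrite /is_game -(eqn_add2l #|val m|) cardsC card_ord card_game. Qed.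

Definition compl_game (m : game 4) : game 4 := exist _ (~: val m) (is_game_setC m).

Lemma compl_game_neq (m : game 4) : m != compl_game m.
Proof.
have [i im] := game_inhabited m; apply/eqP => mE.
by have := im; rewrite mE inE im.
Qed.

Lemma is_perfect_matching_compl (m : game 4) :
  is_perfect_matching [set m; compl_game m].
Proof.
apply/forallP => i; apply/cards1P; have [im|im] := boolP (i \in val m).
  exists m; apply/setP => m'; rewrite !inE.
  by case: eqP => [->|_]; rewrite ?im //=; case: eqP => // ->; rewrite inE im.
exists (compl_game m); apply/setP => m'; rewrite !inE.
case: eqP => [->|_] /=; first by rewrite (negbTE im) (negbTE (compl_game_neq m)).
by case: eqP => // ->; rewrite inE.
Qed.

Lemma disjoint_games4 (m m' : game 4) :
  [disjoint val m & val m'] -> m' = compl_game m.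
Proof.
move=> dis; apply: val_inj; apply/eqP; rewrite eqEcard /=.
by rewrite subsetC -disjoints_subset dis (eqP (is_game_setC m)) card_game.
Qed.

(** With four teams, a perfect matching is a game together with the complementary
    game; each game thus lies in exactly one perfect matching. *)
Lemma perfect_matching4E (M : perfect_matching 4) (m : game 4) :
  m \in val M -> val M = [set m; compl_game m].
Proof.
move=> mM; have other m' : m' \in val M -> m' != m -> m' = compl_game m.
  move=> m'M m'm; apply: disjoint_games4; rewrite -setI_eq0.
  apply: contraNT m'm => /set0Pn[i]; rewrite inE => /andP[im im'].
  have [m0 m0E] := matching_game_of M i.
  by have := m0E m; have := m0E m'; rewrite im im' m'M mM => /esym/eqP-> /esym/eqP->.
have [i im] := game_inhabited (compl_game m).
have [m0 m0E] := matching_game_of M i.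
have /andP[im0 m0M] : (i \in val m0) && (m0 \in val M) by rewrite m0E.
have m0m : m0 != m by apply: contraTneq im0 => ->; move: im; rewrite inE.
apply/setP => m'; rewrite !inE; apply/idP/orP => [m'M|[]/eqP-> //].
  by have [->|/(other _ m'M)->] := eqVneq m' m; [left|right].
by rewrite -(other _ m0M m0m).
Qed.

(** Two games share one team unless they are equal or complementary. *)
Lemma card_setI_game4 (m m' : game 4) :
  (#|val m' :&: val m| + (m' == compl_game m) = 1 + (m' == m))%N.
Proof.
have [->|m'm] := eqVneq m' m.
  by rewrite setIid card_game (negbTE (compl_game_neq m)).
have [->|m'C] := eqVneq m' (compl_game m).
  by rewrite [_ :&: _]setIC setICr cards0.
have lt2 : (#|val m' :&: val m| < 2)%N.
  rewrite -[X in (_ < X)%N](card_game m') proper_card // properEneq subsetIl andbT.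
  apply: contraNneq m'm => /setIidPl sub; apply/eqP/val_inj/eqP.
  by rewrite eqEcard sub !card_game.
have gt0 : (0 < #|val m' :&: val m|)%N.
  rewrite card_gt0; apply: contraNneq m'C => /eqP; rewrite setI_eq0 disjoint_sym.
  by move/disjoint_games4->.
by rewrite !addn0; apply/eqP; rewrite eqn_leq gt0 -ltnS lt2.
Qed.

(** Count the incidences with [val m] in round [r], of total weight 2, and the
    incidences with all teams, of total weight 4.  By [card_setI_game4] the first
    total is half the second one plus the difference of the weights of [m] and of
    its complement. *)
Lemma tra_compl (x : game 4 -> round 4 -> R) m r :
  tra_feasible x -> x (compl_game m) r = x m r.
Proof.
move=> fx.
have two := tra_incidences (val m) r fx; rewrite card_game in two.
have := tra_incidences setT r fx; rewrite cardsT card_ord.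
under eq_bigr do rewrite setIT card_game.
rewrite sumrMnl => tot.
have : \sum_m' x m' r *+ (#|val m' :&: val m| + (m' == compl_game m)) =
       \sum_m' x m' r *+ (1 + (m' == m)).
  by apply: eq_bigr => m' _; rewrite card_setI_game4.
under eq_bigr do rewrite mulrnDr; rewrite big_split /= two.
under [RHS]eq_bigr do rewrite mulrnDr; rewrite big_split /=.
have one m0 : \sum_m' x m' r *+ (m' == m0) = x m0 r.
  by rewrite (bigD1 m0) //= eqxx big1 ?addr0 // => m' /negbTE->.
rewrite !one => *; lra.
Qed.

(** By [tra_compl] both games of a perfect matching have the same weight, which is
    the weight to give to that matching. *)
Lemma v_tra_mat4 (I : srr_instance 4) : v_tra R I = v_mat R I.
Proof.
apply: lp_min_image => [x fx|y /mat_to_tra[x fx xy]]; last first.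
  by exists x; rewrite ?(mat_marginal_cost I xy).
pose y (M : perfect_matching 4) r := 2%:R^-1 * \sum_(m in val M) x m r.
have xy : mat_marginal x y.
  move=> m r; pose M0 : perfect_matching 4 :=
    exist (@is_perfect_matching 4) _ (is_perfect_matching_compl m).
  rewrite (big_pred1 M0) => [|M]; last first.
    apply/idP/eqP => [/perfect_matching4E ME|->]; first exact: val_inj.
    by rewrite !inE eqxx.
  rewrite /y /= big_setU1 ?inE ?compl_game_neq // big_set1 tra_compl //= -mulr2n.
  by rewrite -[X in _ * X = _]mulr_natl mulKf ?pnatr_eq0.
have [x0 _ _] := fx.
exists y; last exact: mat_marginal_cost.
apply: mat_marginal_feasible fx => // M r.
by rewrite mulr_ge0 ?invr_ge0 ?ler0n ?sumr_ge0.
Qed.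

End FourTeams.

(** * Feasibility of the matching formulation *)

Lemma card_games_of n (i : team n) : #|[set m : game n | i \in val m]| = n.-1.
Proof.
rewrite -sum1dep_card (sum_opponents i (fun=> 1%N)) sum1_card.
by rewrite cardC1 card_ord.
Qed.

Section CircleMethod.
Variable k : nat.
Hypothesis odd_k : odd k.

Lemma double_mod_inj a b : (a < k)%N -> (b < k)%N ->
  (a * 2 = b * 2 %[mod k])%N -> a = b.
Proof.
wlog ab : a b / (a <= b)%N => [hw|] ak bk.
  by case/orP: (leq_total a b) => ? ?; [exact: hw | exact/esym/hw].
move/esym/eqP; rewrite eqn_mod_dvd ?leq_mul2r // -mulnBl Gauss_dvdl ?coprimen2 //.
have [ba _|/dvdn_leq h /h] := posnP (b - a); lia.
Qed.

Let k_gt0 : (0 < k)%N. Proof. by case: k odd_k. Qed.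

(** The circle method.  The team [ord_max] sits at the centre and the others are
    the residues modulo the odd number [k].  Residues [i] and [j] meet in round
    [i + j], and [i] meets the centre in the round [i + i] in which it would
    otherwise meet itself.  Since the centre has index [k], which is zero modulo
    [k], both cases are given by one expression symmetric in the two teams. *)
Definition circle_round (m : game k.+1) : round k.+1 :=
  Ordinal (ltn_pmod ((\sum_(i in val m) i) * (1 + (ord_max \in val m)))%N k_gt0).

(** A team other than the centre meets [j] in round [i + j], or [i + i] for the
    centre, and it never meets itself.  For the centre, injectivity is that of
    doubling modulo the odd number [k]. *)
Lemma circle_round_inj (i : team k.+1) :
  {in [set m : game k.+1 | i \in val m] &, injective circle_round}.
Proof.
have pairE (j : team k.+1) (ij : i != j) :
    circle_round (pair_game ij) =
    ((i + j) * (1 + ((i == ord_max) || (j == ord_max))) %% k)%N :> nat.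
  by rewrite /= big_setU1 ?inE //= big_set1 ![ord_max == _]eq_sym.
have mod_inj a b c : (a < k)%N -> (b < k)%N -> c + a = c + b %[mod k] -> a = b.
  by move=> ak bk /eqP; rewrite eqn_modDl !modn_small // => /eqP.
have lt_k (j : team k.+1) : j != ord_max -> (j < k)%N.
  by rewrite -val_eqE /= => jk; rewrite ltn_neqAle jk -ltnS ltn_ord.
have double_oo a : ((a + k) * (1 + 1) = a + a %[mod k])%N.
  by rewrite (_ : (_ * _ = 2 * k + (a + a))%N) ?modnMDl //; lia.
move=> m m'; rewrite !inE => /gameP[j [ij ->]] /gameP[j' [ij' ->]] 
  /(congr1 (@nat_of_ord _)).
rewrite !pairE => cE; suff jj : j = j' by apply: val_inj; rewrite /= jj.
apply: val_inj => /=; move: ij ij' cE.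
have [->|/lt_k ik] := eqVneq i ord_max.
  rewrite ![ord_max == _]eq_sym => /lt_k jk /lt_k j'k /= /eqP.
  by rewrite !mulnDl eqn_modDl => /eqP /(double_mod_inj jk j'k).
have [->|/lt_k jk] := eqVneq j ord_max;
  have [->|/lt_k j'k] := eqVneq j' ord_max => //=; rewrite ?muln1.
- move=> _ ij'; rewrite double_oo => /(mod_inj _ _ _ ik j'k)/val_inj ii.
  by rewrite ii eqxx in ij'.
- move=> ij _; rewrite double_oo => /(mod_inj _ _ _ jk ik)/val_inj ji.
  by rewrite ji eqxx in ij.
- by move=> _ _; exact: mod_inj.
Qed.

Definition circle_matching (r : round k.+1) : {set game k.+1} :=
  [set m | circle_round m == r].

(** A team has as many games as there are rounds, so the injective map from its
    games to the rounds is onto: it plays exactly once in each round. *)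
Lemma circle_matching_perfect r : is_perfect_matching (circle_matching r).
Proof.
apply/forallP => i; pose G := [set m : game k.+1 | i \in val m].
have /setP/(_ r) : circle_round @: G = setT.
  apply/eqP; rewrite eqEcard subsetT cardsT card_ord card_in_imset.
    by rewrite card_games_of leqnn.
  exact: circle_round_inj.
rewrite inE => /imsetP[m mG rE]; apply/cards1P; exists m; apply/setP => m'.
rewrite !inE; apply/andP/eqP => [[/eqP rE' im']|->]; last first.
  by rewrite rE eqxx; move: mG; rewrite inE.
by apply: (circle_round_inj (i := i)) => //; rewrite ?inE // rE'.
Qed.

Lemma circle_feasible (R : realType) : exists y, @mat_feasible R k.+1 y.
Proof.
pose M r : perfect_matching k.+1 :=
  exist (@is_perfect_matching k.+1) _ (circle_matching_perfect r).
have one (T : finType) (a : T) : \sum_t (t == a)%:R = 1 :> R.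
  by rewrite (bigD1 a) //= eqxx big1 ?addr0 // => t /negbTE->.
exists (fun M' r => (M' == M r)%:R); split=> [M' r|r|m]; first exact: ler0n.
  exact: one.
rewrite exchange_big /= -[RHS](one _ (circle_round m)); apply: eq_bigr => r _.
have [rE|rE] := eqVneq r (circle_round m).
  rewrite (bigD1 (M r)) ?inE /= ?rE // eqxx big1 ?addr0 //.
  by move=> M' /andP[_ /negbTE->].
rewrite big1 // => M' mM'; case: eqP => // M'E.
by move: mM'; rewrite M'E inE eq_sym (negbTE rE).
Qed.

End CircleMethod.

Lemma mat_feasible_exists (R : realType) n : (0 < n)%N -> ~~ odd n ->
  exists y, @mat_feasible R n y.
Proof. by case: n => // k _ /negbNE odd_k; exact: circle_feasible. Qed.

(** * An instance that separates the formulations *)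

Section OddCut.
Variables (R : realType) (n : nat) (S : {set team n}) (r0 : round n).
Hypothesis odd_S : odd #|S|.
Hypothesis S_gt1 : (1 < #|S|)%N.
Hypothesis SC_gt1 : (1 < #|~: S|)%N.

(** Penalises the games of round [r0] between [S] and its complement: those are
    the ones with an odd number of sides in [S]. *)
Definition cut_instance : srr_instance n :=
  fun m r => ((r == r0) && odd #|val m :&: S| : nat).

(** The uniform weights on the games inside [A] for which each team of [A] has
    total weight 1. *)
Definition inner (A : {set team n}) (m : game n) : R :=
  (val m \subset A)%:R / (#|A|.-1)%:R.

Lemma inner_degree (A : {set team n}) i : (1 < #|A|)%N ->
  \sum_(m : game n | i \in val m) inner A m = (i \in A)%:R.
Proof.
move=> A1; rewrite (sum_opponents i (fun B => (B \subset A)%:R / (#|A|.-1)%:R)).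
under eq_bigr do rewrite subUset !sub1set.
have [iA|iA] /= := boolP (i \in A); last by rewrite big1 // => j; rewrite mul0r.
rewrite -mulr_suml -natr_sum.
have -> : (\sum_(j | j != i) (j \in A))%N = #|A|.-1.
  rewrite (cardsD1 i A) iA /= -sum1_card [RHS]big_mkcond [LHS]big_mkcond.
  by apply: eq_bigr => j _; rewrite !inE; do 2!case: ifP => //= ->.
by rewrite divff // pnatr_eq0; lia.
Qed.

Lemma inner_ge0 (A : {set team n}) m : 0 <= inner A m.
Proof. by rewrite divr_ge0. Qed.

(** A game is not inside both [S] and its complement; this leaves a nonnegative
    remainder for the other rounds. *)
Lemma inner_sum_le1 m : inner S m + inner (~: S) m <= 1.
Proof.
have bound (A : {set team n}) : (1 < #|A|)%N -> inner A m <= (val m \subset A)%:R.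
  move=> A1; rewrite ler_pdivrMr ?ltr0n; last lia.
  by rewrite ler_peMr ?ler0n // ler1n; lia.
apply: (le_trans (lerD (bound _ S_gt1) (bound _ SC_gt1))).
rewrite -natrD -[1]/(1%:R) ler_nat.
have [i im] := game_inhabited m.
have [/subsetP/(_ i im)|] := boolP (val m \subset S);
  have [/subsetP/(_ i im)|] := boolP (val m \subset ~: S) => //.
by rewrite inE => /negbTE->.
Qed.

(** Round [r0] is played inside [S] and inside its complement; what remains of
    each game is spread evenly over the other [n.-2] rounds. *)
Definition cut_point (m : game n) (r : round n) : R :=
  let u := inner S m + inner (~: S) m in
  if r == r0 then u else (1 - u) / (n.-2)%:R.

Let n_gt2 : (0 < n.-2)%N.
Proof. have := cardsC S; rewrite card_ord; lia. Qed.

Lemma cut_point_feasible : tra_feasible cut_point.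
Proof.
have n20 : (n.-2)%:R != 0 :> R by rewrite pnatr_eq0 -lt0n.
split=> [m r|m|i r]; rewrite /cut_point.
- case: ifP => _; first by rewrite addr_ge0 ?inner_ge0.
  by rewrite divr_ge0 // subr_ge0 inner_sum_le1.
- set u := inner S m + inner (~: S) m.
  rewrite (bigD1 r0) //= eqxx (eq_bigr (fun=> (1 - u) / (n.-2)%:R)).
    rewrite sumr_const cardC1 card_ord -[X in _ + X]mulr_natr divfK //.
    by rewrite addrC subrK.
  by move=> r /negbTE->.
have u1 : \sum_(m : game n | i \in val m) (inner S m + inner (~: S) m) = 1.
  rewrite big_split /= !inner_degree // inE.
  by case: (i \in S); rewrite ?addr0 ?add0r.
case: (r == r0); first exact: u1.
rewrite -mulr_suml sumrB u1 sumr_const.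
have -> : #|[pred m : game n | i \in val m]| = (n.-2).+1.
  have := card_games_of i; rewrite cardsE => ->; lia.
by rewrite -[in X in X / _]natr1 addrK divff.
Qed.

Lemma cut_point_cost : tra_cost cut_instance cut_point = 0.
Proof.
apply: big1 => m _; apply: big1 => r _; rewrite /cut_instance /cut_point.
case: eqP => _ /=; last by rewrite mul0r.
case: (boolP (odd _)) => [om|]; last by rewrite mul0r.
rewrite /inner; have [mS|_] := boolP (val m \subset S).
  by move: om; rewrite (setIidPl mS) card_game.
have [|_] := boolP (val m \subset ~: S); last by rewrite !mul0r addr0 mulr0.
by rewrite -disjoints_subset -setI_eq0 => /eqP mS; move: om; rewrite mS cards0.
Qed.

(** A perfect matching covers the odd set [S], so one of its games covers an odd
    number of teams of [S]. *)
Lemma matching_crosses_cut (M : perfect_matching n) :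
  exists2 m, m \in val M & odd #|val m :&: S|.
Proof.
apply/exists_inP; apply: contraT; rewrite negb_exists_in => /forall_inP evenM.
have : odd (\sum_(m in val M) #|val m :&: S|)%N.
  have -> // : (\sum_(m in val M) #|val m :&: S| = #|S|)%N.
  under eq_bigr do rewrite -sum1_card.
  rewrite (exchange_big_dep (mem S)) /=; last by move=> m i _; rewrite inE => /andP[].
  rewrite -sum1_card; apply: eq_bigr => i iS.
  have [m0 m0E] := matching_game_of M i.
  by rewrite (big_pred1 m0) // => m /=; rewrite inE iS andbT andbC m0E.
by rewrite (big_morph odd oddD (erefl _)) big1 // => m mM; exact/negbTE/evenM.
Qed.

Lemma cut_mat_cost_ge1 (y : perfect_matching n -> round n -> R) :
  mat_feasible y -> 1 <= mat_cost cut_instance y.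
Proof.
move=> [y0 y1 _]; rewrite -(y1 r0) /mat_cost; apply: ler_sum => M _.
have c0 r : 0 <= matching_cost cut_instance M r by apply: sumr_ge0.
rewrite (bigD1 r0) //= -[leLHS]addr0 lerD //; last first.
  by apply: sumr_ge0 => r _; rewrite mulr_ge0 ?ler0z.
rewrite ler_peMl // ler1z; have [m mM om] := matching_crosses_cut M.
rewrite /matching_cost (bigD1 m) //= {1}/cut_instance eqxx om /= lerDl.
by apply: sumr_ge0.
Qed.

End OddCut.

(** * Comparison of the three formulations *)

Lemma v_tra_le_mat (R : realType) n (I : srr_instance n) :
  (0 < n)%N -> ~~ odd n -> v_tra R I <= v_mat R I.
Proof.
move=> n0 en; have matE := mat_feasible_exists R n0 en.
have [y fy miny] := mat_attained I matE.
have [x fx xy] := mat_to_tra fy.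
have [|x' fx' minx'] := @tra_attained R n I; first by exists x.
rewrite /v_mat (lp_minE fy miny) /v_tra (lp_minE fx' minx').
by rewrite (mat_marginal_cost I xy) minx'.
Qed.

(** Take for [S] three teams; as [n] is at least 6, the complement also has more
    than one team. *)
Lemma v_tra_lt_mat (R : realType) n : ~~ odd n -> (6 <= n)%N ->
  exists I : srr_instance n, v_tra R I < v_mat R I.
Proof.
move=> en n6; have n0 : (0 < n)%N by lia.
have r_lt : (0 < n.-1)%N by lia.
pose S : {set team n} := [set i : 'I_n | (i < 3)%N].
have S3 : #|S| = 3%N.
  rewrite -sum1dep_card -(@big_ord_widen _ _ _ 3 n (fun=> 1%N)); last lia.
  by rewrite sum1_card card_ord.
have SC : #|~: S| = (n - 3)%N by have := cardsC S; rewrite card_ord S3; lia.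
pose r0 : round n := Ordinal r_lt; pose I := cut_instance S r0; exists I.
have [y fy miny] := mat_attained I (mat_feasible_exists R n0 en).
have fx : tra_feasible (cut_point R S r0) by apply: cut_point_feasible; lia.
have [|x' fx' minx'] := @tra_attained R n I; first by exists (cut_point R S r0).
rewrite /v_mat (lp_minE fy miny) /v_tra (lp_minE fx' minx').
apply: le_lt_trans (minx' _ fx) _; rewrite cut_point_cost.
by apply: lt_le_trans (cut_mat_cost_ge1 _ _ fy); rewrite ?S3 ?ltr01.
Qed.

Theorem theorem3p5 (R : realType) :
  (forall n : nat, ~~ odd n -> (6 <= n)%N ->
     [/\ relaxation_equivalent (@v_tra R n) (@v_per R n),
         stronger (@v_mat R n) (@v_tra R n)
       & stronger (@v_mat R n) (@v_per R n)]) /\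
  [/\ relaxation_equivalent (@v_tra R 4) (@v_mat R 4),
      relaxation_equivalent (@v_mat R 4) (@v_per R 4)
    & relaxation_equivalent (@v_tra R 4) (@v_per R 4)].
Proof.
have tra_per n : @v_tra R n = @v_per R n by apply/funext => I; exact: v_tra_per.
have tra_mat4 : @v_tra R 4 = @v_mat R 4 by apply/funext => I; exact: v_tra_mat4.
split=> [n en n6|]; last by rewrite -tra_mat4 -tra_per.
have st : stronger (@v_mat R n) (@v_tra R n).
  by split=> [I|]; [apply: v_tra_le_mat => //; lia | exact: v_tra_lt_mat].
by rewrite -tra_per.
Qed.
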